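(* Let $1\le p<2$, $N\in\mathbb N$, $d,n\ge1$, let $f=(f_1,\dots,f_d)$ be vector fields on $\mathbb R^n$ of class $C^1_b$, let $\mathbf w=(\mathbf w_0,\dots,\mathbf w_N)$ be a time series in $\mathbb R^d$, and let $\mathbf x$ solve $\mathbf x_{k+1}=\mathbf x_k+\sum_{\mu=1}^df_\mu(\mathbf x_k)(\mathbf w^\mu_{k+1}-\mathbf w^\mu_k)$, $\mathbf x_0=\xi\in\mathbb R^n$. Then for all $0\le k<l\le N$, \[ \|\mathbf x\|_{p;[k,l]}\le 2\Big(2^pC_{p,N}^{p-1}\|f\|^p_{C^1_b}\|\mathbf w\|^p_{p;[k,l]}\ \vee\ 2\|f\|_{C^1_b}\|\mathbf w\|_{p;[k,l]}\Big), \] where $C_{p,N}\coloneqq 2^{2/p}\zeta_N(2/p)$ and $\zeta_N(s)=\sum_{j=1}^Nj^{-s}$.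
   Context: $\mathbb R^n$ carries a fixed norm, $\mathbb R^d$ the $\ell^1$ norm; derivatives use operator norms. $\|f\|_{C^1_b}\coloneqq\max_\mu\max(\|f_\mu\|_\infty,\|Df_\mu\|_\infty)$. For $0\le k<l\le N$, $\mathcal S_{k,l}$ is the set of increasing integer sequences $s=(s_0=k<s_1<\dots<s_m<s_{m+1}=l)$, $\#s=m$, and $\|\mathbf w\|_{p;[k,l]}\coloneqq(\max_{s\in\mathcal S_{k,l}}\sum_{j=0}^{\#s}|\mathbf w_{s_{j+1}}-\mathbf w_{s_j}|^p)^{1/p}$; $a\vee b=\max(a,b)$. *)

(* Defs.v *)
From HB Require Import structures.
From mathcomp Require Import all_boot all_order all_algebra.
From mathcomp Require Import all_classical all_reals.
From mathcomp Require Import topology normedtype derive exp.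
Set Implicit Arguments. Unset Strict Implicit. Unset Printing Implicit Defensive.
Import Order.TTheory GRing.Theory Num.Theory.
Import numFieldNormedType.Exports.
Local Open Scope classical_set_scope.
Local Open Scope ring_scope.

Section Defs.
Variable R : realType.

Definition is_norm (V : lmodType R) (nrm : V -> R) : Prop :=
  [/\ forall x y, nrm (x + y) <= nrm x + nrm y,
      forall (a : R) x, nrm (a *: x) = `|a| * nrm x
    & forall x, nrm x = 0 -> x = 0].

Definition l1norm (d : nat) (v : 'rV[R]_d) : R := \sum_(i < d) `|v ord0 i|.

Definition incr_seq (k l : nat) (s : seq nat) : bool := path ltn k (rcons s l).

Definition pvar_sum (V : zmodType) (nm : V -> R) (p : R) (w : nat -> V)
  (k l : nat) (s : seq nat) : R :=
  let pts := k :: rcons s l in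
  \sum_(j < (size s).+1) (nm (w (nth 0%N pts j.+1) - w (nth 0%N pts j))) `^ p.

(* ||w||_{p;[k,l]} : the maximum over the finite set S_{k,l} (written as sup) *)
Definition pvar (V : zmodType) (nm : V -> R) (p : R) (w : nat -> V)
  (k l : nat) : R :=
  (sup [set pvar_sum nm p w k l s | s in [set s | incr_seq k l s]]) `^ p^-1.

Definition opnorm (n : nat) (nrm : 'rV[R]_n -> R) (L : 'rV[R]_n -> 'rV[R]_n) : R :=
  sup [set nrm (L v) | v in [set v | nrm v <= 1]].

Definition supnorm (n : nat) (nrm : 'rV[R]_n -> R) (g : 'rV[R]_n -> 'rV[R]_n) : R :=
  sup [set nrm (g x) | x in setT].

Definition dsupnorm (n : nat) (nrm : 'rV[R]_n -> R) (g : 'rV[R]_n -> 'rV[R]_n) : R :=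
  sup [set opnorm nrm ('d g x : 'rV[R]_n -> 'rV[R]_n) | x in setT].

(* g is C^1_b : C^1 (differentiable with continuous derivative; in finite
   dimension continuity of x |-> Dg(x) is continuity of each x |-> Dg(x) v),
   with g and Dg bounded *)
Definition C1b (n : nat) (nrm : 'rV[R]_n -> R) (g : 'rV[R]_n -> 'rV[R]_n) : Prop :=
  [/\ forall x, differentiable g x,
      forall v, continuous (fun x => ('d g x : 'rV[R]_n -> 'rV[R]_n) v),
      exists M, forall x, nrm (g x) <= M
    & exists M, forall x v, nrm ('d g x v) <= M * nrm v].

Definition C1b_norm (n d : nat) (nrm : 'rV[R]_n -> R)
  (f : 'I_d -> 'rV[R]_n -> 'rV[R]_n) : R :=
  \big[Num.max/0]_(mu < d) Num.max (supnorm nrm (f mu)) (dsupnorm nrm (f mu)).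

Definition zetaN (N : nat) (s : R) : R := \sum_(1 <= j < N.+1) (j%:R) `^ (- s).

Definition CpN (p : R) (N : nat) : R := 2 `^ (2 / p) * zetaN N (2 / p).

End Defs.

(* Main.v *)
Require Import Defs.
From HB Require Import structures.
From mathcomp Require Import all_boot all_order all_algebra.
From mathcomp Require Import all_classical all_reals.
From mathcomp Require Import topology normedtype derive exp.
From mathcomp Require Import interval_inference convex hoelder lra ring zify.
Import Order.TTheory GRing.Theory Num.Theory.
Import numFieldNormedType.Exports.
Local Open Scope classical_set_scope.
Local Open Scope ring_scope.

(* Write W and X for the p-variations of w and x, and F for the C^1_b norm of f. The remainder
   Rem(a,b) = x_b - x_a - sum_mu f_mu(x_a) (w_b - w_a)^mu vanishes on single steps, and its
   additivity defect is bounded by F |x_b - x_a| |w_c - w_b|. Young's argument (remove the points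
   of a partition one at a time, always the one with the smallest defect) gives
   |Rem(a,b)| <= C F X W, hence X <= F (1 + C X) W on every interval, and X <= 2 F W wherever
   2 C F W <= 1. In general the interval is cut greedily into blocks on which 2 C F W just exceeds
   1; X is subadditive and W^p superadditive under concatenation, so summing over the blocks gives
   C X <= 2 (2 C F W)^p. *)

(** * Sums over the links of an increasing chain of integers *)

(** The starting point is kept apart from the list of later points, so that concatenating chains is
    [++] and the empty list is a chain without links. *)
Fixpoint chain_sum {V : zmodType} (g : nat -> nat -> V) (k : nat) (t : seq nat) : V :=
  if t is u :: t' then g k u + chain_sum g u t' else 0.

Section ChainSum.
Variable V : zmodType.
Implicit Types (g : nat -> nat -> V) (k l : nat) (t : seq nat).

Lemma chain_sum_cat g k t1 t2 :
  chain_sum g k (t1 ++ t2) = chain_sum g k t1 + chain_sum g (last k t1) t2.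
Proof. by elim: t1 k => [|u t1 IH] k /=; rewrite ?add0r// IH addrA. Qed.

Lemma chain_sum_nth g k t :
  chain_sum g k t = \sum_(j < size t) g (nth 0%N (k :: t) j) (nth 0%N (k :: t) j.+1).
Proof.
elim: t k => [|u t IH] k; first by rewrite big_ord0.
by rewrite /= big_ord_recl /= IH.
Qed.

Lemma path_ltn_le_last k t : path ltn k t -> (k <= last k t)%N.
Proof.
elim: t k => [|u t IH] k //= /andP[ku /IH]; exact/leq_trans/ltnW.
Qed.

Lemma chain_sum_telescope (G : nat -> V) k t : path ltn k t ->
  chain_sum (fun a b => \sum_(a <= i < b) G i) k t = \sum_(k <= i < last k t) G i.
Proof.
elim: t k => [|u t IH] k /=; first by rewrite big_geq.
move=> /andP[ku pt]; rewrite IH// [RHS](big_cat_nat _ (n := u))//; first exact: ltnW.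
exact: path_ltn_le_last.
Qed.

End ChainSum.

Section ChainSumOrder.
Variable R : realType.
Implicit Types (g h : nat -> nat -> R) (k l : nat) (t : seq nat).

Lemma ler_chain_sum g h k l t : path ltn k t -> last k t = l ->
  (forall a b, (k <= a)%N -> (a < b)%N -> (b <= l)%N -> g a b <= h a b) ->
  chain_sum g k t <= chain_sum h k t.
Proof.
elim: t k => [|u t IH] k //= /andP[ku pt] tl gh; apply: lerD.
  by apply: gh => //; rewrite -tl; exact: path_ltn_le_last.
by apply: IH => // a b ua; apply: gh; exact: leq_trans (ltnW ku) ua.
Qed.

Lemma chain_sumZ (c : R) g k t :
  chain_sum (fun a b => c * g a b) k t = c * chain_sum g k t.
Proof. by elim: t k => [|u t IH] k /=; rewrite ?mulr0// IH mulrDr. Qed.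

Lemma chain_sum_ge0 g k t : (forall a b, 0 <= g a b) -> 0 <= chain_sum g k t.
Proof. by move=> g0; elim: t k => [|u t IH] k //=; rewrite addr_ge0. Qed.

(** [g a b] is at most [G a], hence at most the sum of [G] over the link from [a] to [b], and these
    link sums telescope. This makes the supremum in [pvar] finite. *)
Lemma chain_sum_bounded g k l : (forall a b, 0 <= g a b) ->
  exists M, forall t, path ltn k t -> last k t = l -> chain_sum g k t <= M.
Proof.
move=> g0; pose G a := \sum_(0 <= b < l.+1) g a b.
exists (\sum_(k <= i < l) G i) => t pt tl.
rewrite -[in leRHS]tl -chain_sum_telescope//.
apply: (@ler_chain_sum _ _ _ l) => // a b ka ab bl.
rewrite (big_ltn ab) ler_wpDr//.
  by rewrite sumr_ge0// => i _; rewrite sumr_ge0.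
rewrite /G (bigD1_seq b) ?iota_uniq//=; last by rewrite mem_index_iota ltnS.
by rewrite ler_wpDr// sumr_ge0.
Qed.

Fixpoint triple_sum (P : nat -> nat -> nat -> R) (k : nat) (t : seq nat) : R :=
  if t is b :: t' then
    (if t' is c :: _ then P k b c else 0) + triple_sum P b t'
  else 0.

(** The minimum is at most the average over the [(size t).-1] triples of consecutive points; the
    induction compares the first triple with the lightest of the others. *)
Lemma exists_light_triple (P : nat -> nat -> nat -> R) k t : (1 < size t)%N ->
  exists t1 b c t2, t = t1 ++ b :: c :: t2 /\
    (size t).-1%:R * P (last k t1) b c <= triple_sum P k t.
Proof.
elim: t k => [|b [|c [|d t]] IH] k // _.
  by exists [::], b, c, [::]; rewrite /= !addr0 mul1r.
have [//|t1 [b' [c' [t2 [tE le1]]]]] := IH b.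
have [le2|/ltW le2] := leP (P k b c) (P (last b t1) b' c').
  exists [::], b, c, (d :: t); split => //=.
  rewrite mulrS mulrDl mul1r lerD2l.
  by apply: le_trans le1; rewrite ler_wpM2l.
exists (b :: t1), b', c', t2; split; first by rewrite tE.
rewrite [size _]/= [_.-1]/= mulrS mulrDl mul1r.
exact: lerD.
Qed.

(** Each link is the left leg of at most one triple and the right leg of at most one. *)
Lemma triple_sum_le (g h : nat -> nat -> R) (A B : R) k t : 0 <= A -> 0 <= B ->
  (forall a b, 0 <= g a b) -> (forall a b, 0 <= h a b) ->
  triple_sum (fun a b c => B * g a b + A * h b c) k t <=
  B * chain_sum g k t + A * chain_sum h k t.
Proof.
move=> A0 B0 g0 h0; pose P a b c := B * g a b + A * h b c.
(* Strengthened for the induction: the first link is never a right leg, so the sum of [h] starts at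
   [b]. *)
have H b s : triple_sum P k (b :: s) <=
    B * chain_sum g k (b :: s) + A * chain_sum h b s.
  elim: s k b => [|c s IH] k b.
    by rewrite /= !mulr0 !addr0 mulr_ge0.
  rewrite [triple_sum _ _ _]/= -/(triple_sum P b (c :: s)).
  have := IH b c; rewrite /P /=; lra.
case: t => [|b t]; first by rewrite /= !mulr0 addr0.
apply: le_trans (H b t) _ => /=.
by rewrite lerD2l ler_wpM2l// lerDr.
Qed.

End ChainSumOrder.

(** * Monotonicity and convexity of real powers *)

Section PowR.
Variable R : realType.

Lemma ler_powR_cancel (p a b : R) : 0 < p -> 0 <= b -> a `^ p <= b `^ p -> a <= b.
Proof.
move=> p0 b0; apply: contraTT; rewrite -!ltNge => ba.
by apply: gt0_ltr_powR => //; rewrite nnegrE ?(ltW (le_lt_trans b0 ba)).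
Qed.

(** Convexity: [e + h] and [P] are convex combinations of [e] and [P + h] with the weights [t] and
    [1 - t] exchanged, and the two convexity bounds add up. *)
Lemma powR_increment (p e h P : R) : 1 <= p -> 0 <= e -> 0 <= h -> e <= P ->
  (e + h) `^ p + P `^ p <= e `^ p + (P + h) `^ p.
Proof.
move=> p1 e0 h0 eP.
(* In this degenerate case the weight [t] would have denominator zero. *)
have [Pe|Pe] := eqVneq (P + h) e.
  have -> : h = 0 by lra.
  have -> : P = e by lra.
  by rewrite addr0.
have d0 : 0 < P + h - e by rewrite subr_gt0 lt_neqAle eq_sym Pe/=; lra.
pose t := (P - e) / (P + h - e).
have t01 : 0 <= t <= 1.
  by rewrite divr_ge0 ?ler_pdivrMr//= ?mul1r; lra.
have tE : t * (P + h - e) = P - e by rewrite divfK ?gt_eqF.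
have mem (z : R) : 0 <= z -> z \in (`[0, +oo[%classic : set R).
  by move=> z0; rewrite inE/= in_itv/= z0.
have cvx (s : R) : 0 <= s <= 1 ->
    (s * e + (1 - s) * (P + h)) `^ p <= s * e `^ p + (1 - s) * (P + h) `^ p.
  move=> /andP[s0 s1].
  by have /= := convex_powR p1 (Itv01 s0 s1) (mem e e0) (mem (P + h) ltac:(lra)).
have {}t01' : 0 <= 1 - t <= 1 by lra.
have := cvx _ t01; have := cvx _ t01'.
have -> : t * e + (1 - t) * (P + h) = e + h by lra.
have -> : (1 - t) * e + (1 - (1 - t)) * (P + h) = P by lra.
lra.
Qed.

End PowR.

(** * The p-variation: superadditivity, monotonicity and triangle inequality *)

Section PVar.
Variables (R : realType) (V : zmodType) (nm : V -> R) (p : R).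
Hypotheses (nm_ge0 : forall v, 0 <= nm v) (p_ge1 : 1 <= p).
Implicit Types (w : nat -> V) (k l : nat) (t : seq nat).

Let p_gt0 : 0 < p. Proof. exact: lt_le_trans p_ge1. Qed.

Definition pincr w (a b : nat) : R := nm (w b - w a) `^ p.

Lemma pincr_ge0 w a b : 0 <= pincr w a b. Proof. exact: powR_ge0. Qed.

Lemma pvar_ge0 w k l : 0 <= pvar nm p w k l. Proof. exact: powR_ge0. Qed.

Lemma pvar_sumE w k l s : pvar_sum nm p w k l s = chain_sum (pincr w) k (rcons s l).
Proof. by rewrite /pvar_sum chain_sum_nth size_rcons. Qed.

Lemma pvar_sums_ubound w k l :
  has_ubound [set pvar_sum nm p w k l s | s in [set s | incr_seq k l s]].
Proof.
have [M HM] := @chain_sum_bounded R _ k l (pincr_ge0 w).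
by exists M => _ [s ps <-]; rewrite pvar_sumE HM// last_rcons.
Qed.

(** Undoing the root needs a nonnegative supremum; if no increasing sequence exists, the supremum of
    the empty set is 0 by convention. *)
Lemma powR_pvar w k l : pvar nm p w k l `^ p =
  sup [set pvar_sum nm p w k l s | s in [set s | incr_seq k l s]].
Proof.
rewrite -powRrM mulVf ?gt_eqF// powRr1//.
set S := (X in sup X); have [->|/set0P[y Sy]] := eqVneq S set0; first by rewrite sup0.
apply: le_trans (ub_le_sup (pvar_sums_ubound w k l) Sy).
by case: Sy => s _ <-; rewrite pvar_sumE chain_sum_ge0//; exact: pincr_ge0.
Qed.

Lemma chain_sum_le_pvar w k l t : path ltn k t -> last k t = l ->
  chain_sum (pincr w) k t <= pvar nm p w k l `^ p.
Proof.
case/lastP: t => [|s u] pt tl; first exact: powR_ge0.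
rewrite last_rcons in tl; subst u.
rewrite powR_pvar; apply: ub_le_sup; first exact: pvar_sums_ubound.
by exists s => //; rewrite pvar_sumE.
Qed.

Lemma pvarxx w k : pvar nm p w k k = 0.
Proof.
rewrite /pvar (_ : [set _ | _ in _] = set0) ?sup0 ?powR0 ?invr_eq0 ?gt_eqF//.
rewrite -subset0 => _ [s /= + _]; rewrite /incr_seq => /(order_path_min ltn_trans).
by rewrite all_rcons ltnn.
Qed.

Lemma pvar_le_chain_sum w k l M : (k <= l)%N ->
  (forall t, path ltn k t -> last k t = l -> chain_sum (pincr w) k t <= M) ->
  pvar nm p w k l `^ p <= M.
Proof.
rewrite leq_eqVlt => /predU1P[<-|kl] HM.
  by rewrite pvarxx powR0 ?gt_eqF//; exact: (HM [::]).
rewrite powR_pvar; apply: ge_sup.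
  by exists (pvar_sum nm p w k l [::]), [::] => //=; rewrite /incr_seq /= kl.
by move=> _ [s ps <-]; rewrite pvar_sumE HM// last_rcons.
Qed.

Lemma nm_incr_le_pvar w k l : (k < l)%N -> nm (w l - w k) <= pvar nm p w k l.
Proof.
move=> kl; apply: (ler_powR_cancel _ p _ _ p_gt0 (pvar_ge0 _ _ _)).
have := @chain_sum_le_pvar w k l [:: l]; rewrite /= addr0 andbT; exact.
Qed.

(** Chains on the two pieces concatenate; the suprema over the first and over the second are taken
    in turn. *)
Lemma pvar_superadditive w k u l : (k <= u)%N -> (u <= l)%N ->
  pvar nm p w k u `^ p + pvar nm p w u l `^ p <= pvar nm p w k l `^ p.
Proof.
move=> ku ul; rewrite -lerBrDr; apply: pvar_le_chain_sum => // t1 p1 l1.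
rewrite lerBrDr addrC -lerBrDr; apply: pvar_le_chain_sum => // t2 p2 l2.
rewrite lerBrDr addrC -[X in _ + chain_sum _ X _]l1 -chain_sum_cat.
by apply: chain_sum_le_pvar; rewrite ?cat_path ?p1 ?last_cat l1.
Qed.

Lemma pvar_mono w k l a b : (k <= a)%N -> (a <= b)%N -> (b <= l)%N ->
  pvar nm p w a b <= pvar nm p w k l.
Proof.
move=> ka ab bl; apply: (ler_powR_cancel _ p _ _ p_gt0 (pvar_ge0 _ _ _)).
have := pvar_superadditive w k a l ka (leq_trans ab bl).
have := pvar_superadditive w a b l ab bl.
have := powR_ge0 (pvar nm p w k a) p; have := powR_ge0 (pvar nm p w b l) p.
move: (pvar nm p w) => P; lra.
Qed.

Lemma chain_sum_pvar w k t : path ltn k t ->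
  chain_sum (fun a b => pvar nm p w a b `^ p) k t <= pvar nm p w k (last k t) `^ p.
Proof.
elim: t k => [|u t IH] k /=; first by rewrite powR_ge0.
move=> /andP[ku pt].
apply: le_trans (pvar_superadditive w k u _ (ltnW ku) (path_ltn_le_last _ _ pt)).
by rewrite lerD2l IH.
Qed.

(** Prepares the two cases of [pvar_triangle]: a cut point that is a vertex, or one strictly inside
    a link. *)
Lemma chain_split k b t : path ltn k t -> (k <= b)%N -> (b <= last k t)%N ->
  exists t1 t2, t = t1 ++ t2 /\
   (last k t1 = b \/ exists v t3, t2 = v :: t3 /\ (last k t1 < b < v)%N).
Proof.
elim: t k => [|u t IH] k /=.
  by move=> _ kb bk; exists [::], [::]; split => //; left; apply/eqP; rewrite eqn_leq kb.
move=> /andP[ku pt]; rewrite leq_eqVlt => /predU1P[<-|kb] bl.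
  by exists [::], (u :: t); split => //; left.
have [bu|ub] := ltnP b u.
  by exists [::], (u :: t); split => //; right; exists u, t; rewrite /= kb bu.
have [t1 [t2 [-> H]]] := IH u pt ub bl.
by exists (u :: t1), t2.
Qed.

(** A chain may jump over [b]. Splitting that link at [b] into parts of size [e <= P] and [h <= Q]
    lowers the sum by at most [(e + h)^p - e^p - h^p], and two uses of [powR_increment] bound this
    by [(P + Q)^p - P^p - Q^p]. *)
Lemma pvar_triangle w a b c : (forall u v, nm (u + v) <= nm u + nm v) ->
  (a <= b)%N -> (b <= c)%N ->
  pvar nm p w a c <= pvar nm p w a b + pvar nm p w b c.
Proof.
move=> nmD ab bc; set P := pvar nm p w a b; set Q := pvar nm p w b c.
have P0 : 0 <= P by exact: pvar_ge0.
have Q0 : 0 <= Q by exact: pvar_ge0.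
have HP t : path ltn a t -> last a t = b -> chain_sum (pincr w) a t <= P `^ p.
  exact: chain_sum_le_pvar.
have HQ t : path ltn b t -> last b t = c -> chain_sum (pincr w) b t <= Q `^ p.
  exact: chain_sum_le_pvar.
have pinc e h P' := @powR_increment R p e h P' p_ge1.
apply: (ler_powR_cancel _ p _ _ p_gt0 (addr_ge0 P0 Q0)).
apply: pvar_le_chain_sum => [|t pt tl]; first exact: leq_trans bc.
clearbody P Q.
have [|t1 [t2 [tE H]]] := @chain_split a b t pt ab; first by rewrite tl.
move: pt tl; rewrite tE cat_path last_cat chain_sum_cat => /andP[p1 p2] tl.
case: H => [l1|[v [t3 [t2E /andP[ub bv]]]]].
  rewrite l1 in p2 tl *.
  have := HP t1 p1 l1; have := HQ t2 p2 tl.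
  (* With [e = 0] the increment inequality is superadditivity of the p-th power. *)
  have := pinc 0 Q P (lexx _) Q0 P0; rewrite powR0 ?gt_eqF// !add0r.
  lra.
move: p2 tl; rewrite t2E /= => /andP[uv p3] tl.
set u := last a t1 in ub uv *.
have H1 : chain_sum (pincr w) a (rcons t1 b) <= P `^ p.
  by apply: HP; rewrite ?rcons_path ?last_rcons ?p1.
have H2 : chain_sum (pincr w) b (v :: t3) <= Q `^ p.
  by apply: HQ; rewrite //= bv.
move: H1 H2; have := chain_sum_ge0 _ _ v t3 (pincr_ge0 w).
have := chain_sum_ge0 _ _ a t1 (pincr_ge0 w); rewrite -cats1 chain_sum_cat /= addr0 -/u /pincr.
set e := nm (w b - w u); set h := nm (w v - w b) => s1 s2 H1 H2.
have eP : e <= P by apply: (ler_powR_cancel _ p _ _ p_gt0) => //; lra.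
have hQ : h <= Q by apply: (ler_powR_cancel _ p _ _ p_gt0) => //; lra.
have I1 := pinc e h P (nm_ge0 _) (nm_ge0 _) eP.
have := pinc h P Q (nm_ge0 _) P0 hQ; rewrite [h + P]addrC [Q + P]addrC => I2.
have : nm (w v - w u) `^ p <= (e + h) `^ p.
  apply: ge0_ler_powR; rewrite ?nnegrE ?addr_ge0 ?nm_ge0 ?(ltW p_gt0)//.
  have := nmD (w v - w b) (w b - w u).
  by rewrite addrA subrK [e + h]addrC.
lra.
Qed.

End PVar.

(** Upgrades a bound on increments to one on the p-variation: the p-th powers on the right sum up
    over a chain by superadditivity, as in [chain_sum_pvar]. *)
Lemma pvar_le_scale (R : realType) (V W : zmodType) (nm : V -> R) (nm' : W -> R)
    (p K : R) (x : nat -> V) (w : nat -> W) (k l : nat) :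
  (forall v, 0 <= nm v) -> 1 <= p -> 0 <= K -> (k <= l)%N ->
  (forall a b, (k <= a)%N -> (a < b)%N -> (b <= l)%N ->
     nm (x b - x a) <= K * pvar nm' p w a b) ->
  pvar nm p x k l <= K * pvar nm' p w k l.
Proof.
move=> nm0 p1 K0 kl H; have p0 : 0 < p by exact: lt_le_trans p1.
apply: (ler_powR_cancel _ p _ _ p0); first by rewrite mulr_ge0 ?pvar_ge0.
apply: pvar_le_chain_sum kl _ => // t pt tl.
rewrite powRM ?pvar_ge0// -[in leRHS]tl.
have CS := @chain_sum_pvar R W nm' p p1 w k t pt.
apply: le_trans (ler_wpM2l (powR_ge0 K p) CS).
rewrite -chain_sumZ; apply: ler_chain_sum tl _ => // a b ka ab bl.
rewrite -powRM ?pvar_ge0// ge0_ler_powR ?nnegrE ?mulr_ge0 ?pvar_ge0 ?(ltW p0)//.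
exact: H.
Qed.

(** * Partial zeta sums *)

Lemma zetaNS (R : realType) (N : nat) (s : R) :
  zetaN N.+1 s = zetaN N s + N.+1%:R `^ (- s).
Proof. exact: big_nat_recr. Qed.

Lemma zetaN_ge0 (R : realType) m (s : R) : 0 <= zetaN m s.
Proof. by rewrite sumr_ge0// => i _; exact: powR_ge0. Qed.

Lemma zetaN_mono (R : realType) m m' (s : R) : (m <= m')%N -> zetaN m s <= zetaN m' s.
Proof.
elim: m' => [|m' IH]; first by rewrite leqn0 => /eqP->.
rewrite leq_eqVlt => /predU1P[->//|mm']; rewrite zetaNS.
by apply: le_trans (IH mm') _; rewrite lerDl powR_ge0.
Qed.

(** The factor [2^(2/p) >= 1] of [CpN] is given away here: removing lightest triples produces the
    zeta sum alone. *)
Lemma zetaN_le_CpN (R : realType) (p : R) m N : 0 <= p -> (m <= N)%N -> zetaN m (2 / p) <= CpN p N.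
Proof.
move=> p0 mN; apply: le_trans (zetaN_mono _ _ _ _ mN) _.
rewrite /CpN ler_peMl ?zetaN_ge0// -[leLHS](powRr0 2) ler_powR ?ler1n//.
exact: divr_ge0.
Qed.

(** * Young's argument: removing points from a partition *)

Section YoungSewing.
Variables (R : realType) (V : zmodType) (nrm : V -> R).
Hypothesis nrmD : forall u v, nrm (u + v) <= nrm u + nrm v.

(** Arithmetic-geometric mean inequality for [b * al] and [a * be]: squaring the hypothesis gives
    the claim times [4 a b], so [a * b = 0] is treated apart. *)
Lemma light_mul_le (r a b al be : R) : 0 <= r -> 0 <= al <= a -> 0 <= be <= b ->
  r * (b * al + a * be) <= 2 * a * b -> r ^+ 2 * (al * be) <= a * b.
Proof.
move=> r0 /andP[al0 ala] /andP[be0 beb] H.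
have a0 : 0 <= a by exact: le_trans ala.
have b0 : 0 <= b by exact: le_trans beb.
have [ab0|ab] := eqVneq (a * b) 0.
  rewrite ab0 (_ : al * be = 0) ?mulr0//; apply/eqP; rewrite eq_le mulr_ge0// andbT.
  by rewrite -ab0 ler_pM.
have {}ab : 0 < a * b by rewrite lt_neqAle eq_sym ab mulr_ge0.
have ab4 : 0 < 4 * (a * b) by rewrite mulr_gt0.
rewrite -(ler_pM2l ab4).
have : (r * (b * al + a * be)) ^+ 2 <= (2 * a * b) ^+ 2.
  by rewrite lerXn2r// nnegrE ?mulr_ge0// addr_ge0// mulr_ge0.
have := sqr_ge0 (r * (b * al - a * be)).
lra.
Qed.

(* Among the [m] interior points of a chain one can be removed at the cost of changing the sum
   of [Rem] by at most [F A B / m^(2/p)]. *)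
Lemma young_sewing (p F A B : R) (Rem : nat -> nat -> V) (g h : nat -> nat -> R)
    (k l : nat) (t : seq nat) :
  0 < p -> 0 <= F -> 0 <= A -> 0 <= B ->
  (forall a b, 0 <= g a b) -> (forall a b, 0 <= h a b) ->
  (forall t, path ltn k t -> last k t = l ->
     chain_sum (fun a b => g a b `^ p) k t <= A `^ p) ->
  (forall t, path ltn k t -> last k t = l ->
     chain_sum (fun a b => h a b `^ p) k t <= B `^ p) ->
  (forall a b c, (k <= a)%N -> (a < b)%N -> (b < c)%N -> (c <= l)%N ->
     nrm (Rem a c - Rem a b - Rem b c) <= F * (g a b * h b c)) ->
  path ltn k t -> last k t = l -> (0 < size t)%N ->
  nrm (Rem k l) <=
    nrm (chain_sum Rem k t) + F * (A * B) * zetaN (size t).-1 (2 / p).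
Proof.
move=> p0 F0 A0 B0 g0 h0 HA HB HR pt tl.
case tm : (size t) => [//|m] _; elim: m t pt tl tm => [|m IH] t pt tl tm.
  (* A single link: the chain sum is [Rem k l] itself and the zeta sum is empty. *)
  case: t pt tl tm => [|u [|]]//= _ -> _.
  by rewrite addr0 /zetaN big_geq// mulr0 addr0.
have gp0 a b : 0 <= g a b `^ p by exact: powR_ge0.
have hp0 a b : 0 <= h a b `^ p by exact: powR_ge0.
(* These weights balance the two sums: each contributes at most [A^p B^p], so the lightest of the
   [m.+1] triples weighs at most [2 A^p B^p / m.+1]. *)
have [|t1 [b [c [t2 [tE tri]]]]] := exists_light_triple R
  (fun a b c => B `^ p * g a b `^ p + A `^ p * h b c `^ p) k t; first by rewrite tm.
have {tri} := le_trans tri (triple_sum_le R _ _ _ _ k t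
  (powR_ge0 A p) (powR_ge0 B p) gp0 hp0).
have HAt := HA t pt tl; have HBt := HB t pt tl.
rewrite tm /= => tri.
have {}tri := le_trans tri (lerD (ler_wpM2l (powR_ge0 B p) HAt)
  (ler_wpM2l (powR_ge0 A p) HBt)).
move: pt tl HAt HBt; rewrite tE cat_path last_cat !chain_sum_cat /=.
move: tri; set a := last k t1 => tri /andP[p1 /and3P[ab bc p2]] tl HAt HBt.
have ka : (k <= a)%N by exact: path_ltn_le_last.
have cl : (c <= l)%N by rewrite -tl path_ltn_le_last.
pose t' := t1 ++ c :: t2.
have pt' : path ltn k t' by rewrite cat_path p1 /= p2 (ltn_trans ab bc).
have tl' : last k t' = l by rewrite last_cat.
have t'm : size t' = m.+1.
  by move: tm; rewrite tE /t' !size_cat /=; lia.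
apply: le_trans (IH _ pt' tl' t'm) _.
(* Removing [b] trades [Rem a b + Rem b c] for [Rem a c], so the sum changes by exactly one
   defect. *)
have E : chain_sum Rem k t' =
   (chain_sum Rem k t1 + (Rem a b + (Rem b c + chain_sum Rem c t2)))
   + (Rem a c - Rem a b - Rem b c).
  rewrite /t' chain_sum_cat /= -/a.
  rewrite -[RHS]addrA; congr (_ + _); rewrite [RHS]addrC addrA.
  by rewrite (addrAC _ (- Rem b c)) subrK addrA subrK.
have := nrmD (chain_sum Rem k t1 + (Rem a b + (Rem b c + chain_sum Rem c t2)))
  (Rem a c - Rem a b - Rem b c); rewrite -E => D1.
have D2 := HR a b c ka ab bc cl.
have s1g := chain_sum_ge0 R _ k t1 gp0; have s2g := chain_sum_ge0 R _ c t2 gp0.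
have s1h := chain_sum_ge0 R _ k t1 hp0; have s2h := chain_sum_ge0 R _ c t2 hp0.
have gA : 0 <= g a b `^ p <= A `^ p by rewrite gp0 /=; have := gp0 b c; lra.
have hB : 0 <= h b c `^ p <= B `^ p by rewrite hp0 /=; have := hp0 a b; lra.
(* On p-th powers, [light_mul_le] with [r = m.+1] gains the square of [m.+1]; hence the exponent
   [2/p]. *)
have gh : g a b * h b c <= A * B * m.+1%:R `^ (- (2 / p)).
  apply: (ler_powR_cancel _ p _ _ p0); first by rewrite !mulr_ge0 ?powR_ge0.
  rewrite !powRM ?mulr_ge0 ?powR_ge0// -powRrM mulNr divfK ?gt_eqF//.
  rewrite powR_invn// ler_pdivlMr ?exprn_gt0// mulrC.
  apply: light_mul_le => //; lra.
rewrite zetaNS.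
have := ler_wpM2l F0 gh.
set z := zetaN m _; set y := _ `^ (- _).
move: D1 D2; move: (nrm _) (nrm _) (nrm _) => n1 n2 n3.
lra.
Qed.

End YoungSewing.

(** * Abstract norms and a mean value inequality on the unit interval *)

Section Norm.
Variables (R : realType) (V : lmodType R) (nrm : V -> R).
Hypothesis nrm_norm : is_norm nrm.

Lemma is_normD u v : nrm (u + v) <= nrm u + nrm v.
Proof. by case: nrm_norm. Qed.

Lemma is_normZ a u : nrm (a *: u) = `|a| * nrm u.
Proof. by case: nrm_norm. Qed.

Lemma is_norm0 : nrm 0 = 0.
Proof. by rewrite -(scale0r 0) is_normZ normr0 mul0r. Qed.

Lemma is_normN u : nrm (- u) = nrm u.
Proof. by rewrite -scaleN1r is_normZ normrN normr1 mul1r. Qed.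

Lemma is_normB u v : nrm (u - v) = nrm (v - u).
Proof. by rewrite -is_normN opprB. Qed.

Lemma is_norm_ge0 u : 0 <= nrm u.
Proof. have := is_normD u (- u); rewrite subrr is_norm0 is_normN; lra. Qed.

Lemma is_norm_sum (I : Type) (r : seq I) (P : pred I) (F : I -> V) :
  nrm (\sum_(i <- r | P i) F i) <= \sum_(i <- r | P i) nrm (F i).
Proof.
elim/big_ind2 : _ => [|u a v b ua vb|//]; first by rewrite is_norm0.
exact: le_trans (is_normD _ _) (lerD ua vb).
Qed.

(** Real induction: the supremum [T] of [A] lies in [A], by the local bound at [T] applied to a
    nearby point of [A]; if [T < 1], the same local bound yields a point of [A] beyond [T]. *)
Lemma local_lipschitz_unit_interval (phi : R -> V) (K : R) :
  (forall t, 0 <= t <= 1 -> exists2 e, 0 < e &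
     forall s, `|s - t| < e -> nrm (phi s - phi t) <= K * `|s - t|) ->
  nrm (phi 1 - phi 0) <= K.
Proof.
move=> H; pose A := [set t | 0 <= t <= 1 /\ nrm (phi t - phi 0) <= K * t].
have A0 : A 0 by split; rewrite ?lexx ?ler01// subrr is_norm0 mulr0.
have Aub : has_ubound A by exists 1 => t [/andP[]].
have supA : has_sup A by split => //; exists 0.
have step s t : nrm (phi t - phi 0) <= K * t -> nrm (phi s - phi t) <= K * (s - t) ->
    nrm (phi s - phi 0) <= K * s.
  by have := is_normD (phi s - phi t) (phi t - phi 0); rewrite addrA subrK; lra.
have T0 : 0 <= sup A by exact: ub_le_sup.
have T1 : sup A <= 1 by apply: ge_sup; [exists 0|move=> t [/andP[]]].
have ubT t : A t -> t <= sup A by exact: ub_le_sup.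
have adT e : 0 < e -> exists2 t, A t & sup A - e < t.
  by move=> e0; apply: sup_adherent.
move: (sup A) T0 T1 ubT adT => T T0 T1 ubT adT.
have [|e e0 He] := H T; first by rewrite T0.
have AT : nrm (phi T - phi 0) <= K * T.
  have [t At tT] := adT e e0; have tT' := ubT t At.
  case: At => _ /step; apply; rewrite is_normB.
  have tTE : `|t - T| = T - t by rewrite ler0_norm ?opprB// subr_le0.
  by rewrite -tTE He// tTE; lra.
have [T1'|T1'] := ltP T 1; last first.
  by move: AT; rewrite (_ : T = 1) ?mulr1//; apply/eqP; rewrite eq_le T1.
(* Halving [e] keeps [s] strictly within the local bound; the minimum keeps it in the unit
   interval. *)
pose s := Num.min 1 (T + e / 2).
have Ts : T < s by rewrite lt_min T1'/= ltrDl divr_gt0.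
have sT : `|s - T| = s - T by rewrite ger0_norm// subr_ge0 ltW.
have : s <= T.
  apply: ubT; split; first by rewrite (ltW (le_lt_trans T0 Ts)) ge_min lexx.
  apply: (step s T) => //; rewrite -sT He// sT.
  have : s <= T + e / 2 by rewrite ge_min lexx orbT.
  lra.
by rewrite leNgt Ts.
Qed.

End Norm.

(** * Norms on row vectors: Lipschitz and operator norm bounds *)

Section RowNorm.
Variables (R : realType) (n : nat) (nrm : 'rV[R]_n -> R).
Hypothesis nrm_norm : is_norm nrm.

(** Limits of difference quotients are taken in the entrywise maximum norm; this comparison carries
    them over to [nrm]. *)
Lemma is_norm_le_mx_norm : exists2 K, 0 <= K & forall u, nrm u <= K * `|u|.
Proof.
exists (\sum_(i < n) nrm (delta_mx 0 i)).
  by rewrite sumr_ge0// => i _; exact: is_norm_ge0.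
move=> u; rewrite {1}[u]row_sum_delta.
apply: le_trans (is_norm_sum _ _ _ nrm_norm _ _ _ _) _.
rewrite mulr_suml; apply: ler_sum => i _.
rewrite (is_normZ _ _ _ nrm_norm) mulrC ler_wpM2l ?is_norm_ge0//.
rewrite [leRHS]/Num.norm/= mx_normrE.
exact: (le_bigmax _ (fun i : 'I_1 * 'I_n => `|u i.1 i.2|) (0, i)).
Qed.

(** Mean value inequality along the segment [phi] from [x] to [y]. Differentiability gives the local
    bound only up to a slack, so the constant carries an arbitrary extra [e]. *)
Lemma differentiable_lipschitz (g : 'rV[R]_n -> 'rV[R]_n) (L : R) :
  (forall x, differentiable g x) ->
  (forall x v, nrm ('d g x v) <= L * nrm v) ->
  forall x y, nrm (g y - g x) <= L * nrm (y - x).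
Proof.
move=> dg Lg x y; set v := y - x; apply/ler_addgt0Pr => e e0.
have [K K0 HK] := is_norm_le_mx_norm.
pose phi (t : R) := g (t *: v + x).
suff : nrm (phi 1 - phi 0) <= L * nrm v + e.
  by rewrite /phi scale1r scale0r add0r /v subrK.
apply: local_lipschitz_unit_interval => // t _.
set a := t *: v + x.
have K1 : 0 < K + 1 by lra.
(* Dividing by [K + 1] avoids a zero denominator, and [K] times this quantity is still at most
   [e]. *)
have e'0 : 0 < e / (K + 1) by rewrite divr_gt0.
have /cvgrPdist_lt/(_ _ e'0) : h^-1 *: ((g \o shift a) (h *: v) - g a) @[h --> 0^'] --> 'd g a v.
  by rewrite -deriveE//; exact: diff_derivable.
rewrite /dnbhs /within /= => /nbhs_ballP[d /= d0 Hd].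
exists d => // s sd.
have [->|st] := eqVneq s t.
  by rewrite !subrr normr0 mulr0 is_norm0.
pose h := s - t; have h0 : h != 0 by rewrite subr_eq0.
have {}Hd := Hd h; rewrite /ball /= sub0r normrN in Hd.
have {}Hd := Hd sd h0.
have phiE : phi s - phi t = h *: ('d g a v - ('d g a v - h^-1 *: (g (h *: v + a) - g a))).
  by rewrite subKr scalerA divff// scale1r /a addrA -scalerDl subrK.
rewrite phiE is_normZ// mulrC ler_wpM2r//.
apply: le_trans (is_normD _ _ _ nrm_norm _ _) _; rewrite is_normN//.
apply: lerD; first exact: Lg.
apply: le_trans (HK _) _.
apply: le_trans (ler_wpM2l K0 (ltW Hd)) _.
by rewrite mulrCA ler_piMr ?(ltW e0)// ler_pdivrMr// mul1r lerDl.
Qed.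

Lemma C1b_supnorm (g : 'rV[R]_n -> 'rV[R]_n) x : C1b nrm g -> nrm (g x) <= supnorm nrm g.
Proof.
case=> _ _ [M HM] _; apply: ub_le_sup; last by exists x.
by exists M => _ [y _ <-].
Qed.

(** By homogeneity it is enough to test vectors of norm one; the uniform bound on the derivative
    makes both nested suprema finite. *)
Lemma C1b_dsupnorm (g : 'rV[R]_n -> 'rV[R]_n) x v : C1b nrm g ->
  nrm ('d g x v) <= dsupnorm nrm g * nrm v.
Proof.
case=> _ _ _ [M HM].
(* The sign of [M] is unknown, hence the absolute value. *)
have HM' y u : nrm u <= 1 -> nrm ('d g y u) <= `|M|.
  move=> u1; apply: le_trans (HM _ _) _; apply: le_trans (ler_norm _) _.
  by rewrite normrM ler_piMr// ger0_norm ?is_norm_ge0.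
have H1 y u : nrm u <= 1 -> nrm ('d g y u) <= opnorm nrm ('d g y : 'rV[R]_n -> 'rV[R]_n).
  move=> u1; apply: ub_le_sup; last by exists u.
  by exists `|M| => _ [z /= z1 <-]; exact: HM'.
have H2 y : opnorm nrm ('d g y : 'rV[R]_n -> 'rV[R]_n) <= dsupnorm nrm g.
  apply: ub_le_sup; last by exists y.
  exists `|M| => _ [z _ <-]; apply: ge_sup.
    by exists (nrm ('d g z 0)), 0 => //=; rewrite is_norm0.
  by move=> _ [u /= u1 <-]; exact: HM'.
have [v0|v0] := eqVneq (nrm v) 0.
  have -> : v = 0 by case: nrm_norm => _ _; exact.
  by rewrite linear0 (is_norm0 _ _ _ nrm_norm) mulr0.
have {}v0 : 0 < nrm v by rewrite lt_neqAle eq_sym v0 is_norm_ge0.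
rewrite -ler_pdivrMr// mulrC.
have := le_trans (H1 x ((nrm v)^-1 *: v) _) (H2 x).
rewrite linearZ /= !is_normZ// ger0_norm ?invr_ge0 ?(ltW v0)// mulVf ?gt_eqF//.
exact.
Qed.

End RowNorm.

(** * Bounds on the vector fields by their [C^1_b] norm *)

Section C1bNorm.
Variables (R : realType) (n d : nat) (nrm : 'rV[R]_n -> R).
Variable f : 'I_d -> 'rV[R]_n -> 'rV[R]_n.
Hypotheses (nrm_norm : is_norm nrm) (fC1 : forall mu, C1b nrm (f mu)).

Lemma C1b_norm_ge0 : 0 <= C1b_norm nrm f.
Proof. exact: bigmax_ge_id. Qed.

Lemma C1b_norm_bound mu y : nrm (f mu y) <= C1b_norm nrm f.
Proof.
apply: le_trans (C1b_supnorm _ _ _ _ y (fC1 mu)) _.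
by apply: (bigmax_sup mu) => //; rewrite le_max lexx.
Qed.

Lemma C1b_norm_lipschitz mu y z :
  nrm (f mu z - f mu y) <= C1b_norm nrm f * nrm (z - y).
Proof.
apply: (differentiable_lipschitz _ _ _ nrm_norm); first by case: (fC1 mu).
move=> u v; apply: le_trans (C1b_dsupnorm _ _ _ nrm_norm _ u v (fC1 mu)) _.
rewrite ler_wpM2r ?is_norm_ge0//.
by apply: (bigmax_sup mu) => //; rewrite le_max lexx orbT.
Qed.

(** Pairs the [l^1] norm of the coefficients with a bound uniform in [mu]; this matches the maximum
    over [mu] in [C1b_norm]. *)
Lemma norm_row_comb (c : 'rV[R]_d) (v : 'I_d -> 'rV[R]_n) (K : R) :
  (forall mu, nrm (v mu) <= K) ->
  nrm (\sum_(mu < d) c ord0 mu *: v mu) <= K * l1norm c.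
Proof.
move=> vK; apply: le_trans (is_norm_sum _ _ _ nrm_norm _ _ _ _) _.
rewrite mulr_sumr; apply: ler_sum => mu _.
by rewrite is_normZ// mulrC ler_wpM2r.
Qed.

End C1bNorm.

(** * Greedy blocks: from local bounds to large intervals *)

Section Greedy.
Variables (R : realType) (p C F : R) (N : nat) (X W : nat -> nat -> R).
Hypotheses (p_ge1 : 1 <= p) (p_lt2 : p < 2) (C_gt0 : 0 < C) (F_ge0 : 0 <= F).
Hypothesis X_ge0 : forall a b, 0 <= X a b.
Hypothesis W_ge0 : forall a b, 0 <= W a b.
Hypothesis X_triangle : forall a b c,
  (a <= b)%N -> (b <= c)%N -> X a c <= X a b + X b c.
Hypothesis W_xx : forall a, W a a = 0.
Hypothesis W_mono : forall k a b l,
  (k <= a)%N -> (a <= b)%N -> (b <= l)%N -> W a b <= W k l.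
Hypothesis W_superadditive : forall a b c,
  (a <= b)%N -> (b <= c)%N -> W a b `^ p + W b c `^ p <= W a c `^ p.
Hypothesis XW_step : forall u, (u < N)%N -> X u u.+1 <= F * W u u.+1.
Hypothesis XW_local : forall a b, (a <= b)%N -> (b <= N)%N ->
  X a b <= F * (1 + C * X a b) * W a b.

Let Om a b := 2 * C * F * W a b.

(** [XW_local] reads [X <= F W + (Om / 2) X]; when [Om <= 1], half of [X] is absorbed on the
    left. *)
Lemma small_variation k l : (k <= l)%N -> (l <= N)%N -> Om k l <= 1 ->
  X k l <= 2 * F * W k l.
Proof.
move=> kl lN; rewrite /Om => Om1.
have := XW_local k l kl lN; have := ler_wpM2r (X_ge0 k l) Om1; lra.
Qed.

(* [l] is reached by successive blocks, each the shortest one on which the rescaled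
   variation [Om] exceeds 1. Such a block contributes at most [3/2 Om^p], and the tail,
   where [Om <= 1], at most [Om <= 1/8 + 2 Om^2 <= 1/8 + 2 Om^p]. *)
Lemma large_variation k l : (k <= l)%N -> (l <= N)%N -> 1 < Om k l ->
  C * X k l <= 2 * Om k l `^ p.
Proof.
have p0 : 0 < p by exact: lt_le_trans p_ge1.
have CF0 : 0 <= 2 * C * F by rewrite !mulr_ge0// ltW.
have Om0 a b : 0 <= Om a b by rewrite mulr_ge0.
have Omp_E a b : Om a b `^ p = (2 * C * F) `^ p * W a b `^ p by exact: powRM.
have [m] := ubnP (l - k); elim: m k => // m IH k klm kl lN Om1.
have exv : exists v, (k <= v)%N && (1 < Om k v) by exists l; rewrite kl.
(* [v] is the first endpoint with [Om k v > 1]. It exceeds [k] because [W k k = 0], so [v = u.+1]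
   with [Om k u <= 1]. *)
have [v /andP[kv Omv] vmin] := ex_minnP exv.
have vl : (v <= l)%N by rewrite vmin// kl.
case: v kv Omv vmin vl => [|u] kv Omv vmin vl.
  by move: Omv; rewrite (_ : k = 0%N) /Om ?W_xx; [lra|lia].
have [kuE|ku] := eqVneq k u.+1.
  by move: Omv; rewrite -kuE /Om W_xx; lra.
have {}ku : (k <= u)%N by lia.
have Omu : Om k u <= 1.
  rewrite leNgt; apply/negP => Omu; have := vmin u; rewrite ku Omu ltnn.
  by move=> /(_ isT).
have uN : (u < N)%N by exact: leq_trans lN.
(* The block is cut before its last step. After scaling by [C], the part up to [u] gives [Om k u]
   and the last step half of [Om u u.+1]; both [Om] are at most [Om k u.+1]. *)
have X1 := small_variation k u ku (ltnW uN) Omu.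
have X2 := XW_step u uN.
have tri1 := X_triangle k u.+1 l kv vl.
have tri2 := X_triangle k u u.+1 ku (leqnSn u).
have Om12 : Om u u.+1 <= Om k u.+1 by rewrite ler_wpM2l// W_mono.
have Omp : Om k u.+1 <= Om k u.+1 `^ p by rewrite le1r_powR// ltW.
have Omsup : Om k u.+1 `^ p + Om u.+1 l `^ p <= Om k l `^ p.
  by rewrite !Omp_E -mulrDr ler_wpM2l ?powR_ge0// W_superadditive.
have tail : C * X u.+1 l <= 8^-1 + 2 * Om u.+1 l `^ p.
  have [r1|r1] := leP (Om u.+1 l) 1; last first.
    have lum : (l - u.+1 < m)%N by clear -klm ku vl; lia.
    by apply: le_trans (IH u.+1 lum vl lN r1) _; rewrite lerDr.
  have X3 : C * X u.+1 l <= Om u.+1 l.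
    have := ler_wpM2l (ltW C_gt0) (small_variation _ _ vl lN r1); rewrite /Om; lra.
  apply: le_trans X3 _.
  have [->|r0] := eqVneq (Om u.+1 l) 0; first by rewrite powR0 ?gt_eqF//; lra.
  have : Om u.+1 l `^ 2 <= Om u.+1 l `^ p.
    by apply: ger_powR; rewrite ?(ltW p_lt2)// lt_neqAle eq_sym r0 Om0.
  (* The 1/8 completes the square: [2 z^2 - z + 1/8 = 2 (z - 1/4)^2]. *)
  rewrite powR_mulrn//; have := sqr_ge0 (Om u.+1 l - 4^-1); lra.
have C1 := ler_wpM2l (ltW C_gt0) X1; have C2 := ler_wpM2l (ltW C_gt0) X2.
have C3 := ler_wpM2l (ltW C_gt0) tri1; have C4 := ler_wpM2l (ltW C_gt0) tri2.
(* Block and tail give at most [3/2 Om^p + 1/8] on [[k, u.+1]] plus [2 Om^p] on the rest; as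
   [Om k u.+1] exceeds 1, the 1/8 fits into the missing half. *)
rewrite /Om in Omu Omv Om12 Omp *; rewrite /Om in Omsup tail; lra.
Qed.

End Greedy.

(** * Increments of the Euler scheme *)

Section Increments.
Variables (R : realType) (p : R) (N d n : nat) (nrm : 'rV[R]_n -> R).
Variables (f : 'I_d -> 'rV[R]_n -> 'rV[R]_n) (w : nat -> 'rV[R]_d) (x : nat -> 'rV[R]_n).
Hypotheses (p_ge1 : 1 <= p) (nrm_norm : is_norm nrm) (fC1 : forall mu, C1b nrm (f mu)).
Hypothesis xE : forall k, (k < N)%N ->
  x k.+1 = x k + \sum_(mu < d) (w k.+1 ord0 mu - w k ord0 mu) *: f mu (x k).

Let F := C1b_norm nrm f.
Let nrm_ge0 := is_norm_ge0 _ _ _ nrm_norm.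

Lemma l1norm_ge0 (v : 'rV[R]_d) : 0 <= l1norm v.
Proof. exact: sumr_ge0. Qed.

Let D a b y : 'rV[R]_n := \sum_(mu < d) (w b - w a) ord0 mu *: f mu y.
Let Rem a b : 'rV[R]_n := x b - x a - D a b (x a).

Lemma remainder_step a : (a < N)%N -> Rem a a.+1 = 0.
Proof.
move=> aN; rewrite /Rem xE// [x a + _]addrC addrK /D.
by apply/eqP; rewrite subr_eq0; apply/eqP/eq_bigr => mu _; rewrite !mxE.
Qed.

(** The increments of [x] cancel; what is left is the change of the fields from [x a] to [x b] along
    [w c - w b], to which the Lipschitz bound applies. *)
Lemma remainder_defect a b c :
  nrm (Rem a c - Rem a b - Rem b c) <= F * (nrm (x b - x a) * l1norm (w c - w b)).
Proof.
have -> : Rem a c - Rem a b - Rem b c =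
    \sum_(mu < d) (w c - w b) ord0 mu *: (f mu (x b) - f mu (x a)).
  have Dac : D a c (x a) = D a b (x a) + D b c (x a).
    rewrite -big_split; apply: eq_bigr => mu _ /=.
    by rewrite -scalerDl !mxE; congr (_ *: _); ring.
  under eq_bigr do rewrite scalerBr.
  rewrite sumrB -/(D b c (x b)) -/(D b c (x a)) /Rem Dac.
  move: (D b c (x b)) (D b c (x a)) (D a b (x a)) => u v z.
  by apply/rowP => i; rewrite !mxE; ring.
rewrite mulrA; apply: norm_row_comb => // mu.
exact: C1b_norm_lipschitz.
Qed.

Let X := pvar nrm p x.
Let W := pvar (@l1norm R d) p w.

Lemma norm_drift_le a b y : nrm (D a b y) <= F * l1norm (w b - w a).
Proof. by apply: norm_row_comb => // mu; exact: C1b_norm_bound. Qed.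

(** Sewing along the finest chain, where every [Rem] vanishes, leaves only the zeta term for
    [Rem a b]; the drift frozen at [x a] is then added. *)
Lemma increment_bound a b : (a < b)%N -> (b <= N)%N ->
  nrm (x b - x a) <= F * (1 + CpN p N * X a b) * W a b.
Proof.
move=> ab bN; have p0 : 0 < p by exact: lt_le_trans p_ge1.
have F0 : 0 <= F by exact: C1b_norm_ge0.
have X0 : 0 <= X a b by exact: pvar_ge0.
have W0 : 0 <= W a b by exact: pvar_ge0.
pose t := iota a.+1 (b - a).
have iota_path m c : path ltn c (iota c.+1 m).
  by elim: m c => //= m IH c; rewrite ltnSn IH.
have iota_last m c : last c (iota c.+1 m) = (c + m)%N.
  by elim: m c => [|m IH] c /=; rewrite ?addn0// IH addSnnS.
have pt : path ltn a t by exact: iota_path.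
have tl : last a t = b by rewrite iota_last subnKC// ltnW.
have szt : size t = (b - a)%N by rewrite size_iota.
have t0 : chain_sum Rem a t = 0.
  have H m c : (c + m <= N)%N -> chain_sum Rem c (iota c.+1 m) = 0.
    elim: m c => //= m IH c cm; rewrite remainder_step ?IH ?addr0//; lia.
  by apply: H; rewrite subnKC// ltnW.
have := @young_sewing R _ nrm (is_normD _ _ _ nrm_norm) p F (X a b) (W a b) Rem
  (fun a b => nrm (x b - x a)) (fun a b => l1norm (w b - w a)) a b t
  p0 F0 X0 W0 (fun _ _ => nrm_ge0 _) (fun _ _ => l1norm_ge0 _)
  (fun s => @chain_sum_le_pvar R _ nrm p p_ge1 x a b s)
  (fun s => @chain_sum_le_pvar R _ (@l1norm R d) p p_ge1 w a b s)
  (fun a b c _ _ _ _ => remainder_defect a b c) pt tl.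
rewrite szt subn_gt0 => /(_ ab); rewrite t0 (is_norm0 _ _ _ nrm_norm) add0r => H.
have Dw : nrm (D a b (x a)) <= F * W a b.
  have lw := @nm_incr_le_pvar R _ (@l1norm R d) p p_ge1 w a b ab.
  exact: le_trans (norm_drift_le a b (x a)) (ler_wpM2l F0 lw).
(* The finest chain has [b - a - 1] interior points, fewer than [N]. *)
have Z : zetaN (b - a).-1 (2 / p) <= CpN p N by apply: zetaN_le_CpN; [exact: ltW|lia].
have := ler_wpM2l (mulr_ge0 F0 (mulr_ge0 X0 W0)) Z.
have := is_normD _ _ _ nrm_norm (Rem a b) (D a b (x a)); rewrite subrK.
move: H Dw; move: (X a b) (W a b) (CpN p N) (zetaN _ _) => X' W' C' Z'.
lra.
Qed.

End Increments.

Theorem theorem5p2 (R : realType) (p : R) (N d n : nat)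
  (nrm : 'rV[R]_n -> R) (f : 'I_d -> 'rV[R]_n -> 'rV[R]_n)
  (w : nat -> 'rV[R]_d) (x : nat -> 'rV[R]_n) (xi : 'rV[R]_n) :
  1 <= p -> p < 2 -> (1 <= d)%N -> (1 <= n)%N ->
  is_norm nrm ->
  (forall mu, C1b nrm (f mu)) ->
  x 0%N = xi ->
  (forall k, (k < N)%N ->
     x k.+1 = x k + \sum_(mu < d) (w k.+1 ord0 mu - w k ord0 mu) *: f mu (x k)) ->
  forall k l, (k < l)%N -> (l <= N)%N ->
  pvar nrm p x k l <=
  2 * Num.max
    (2 `^ p * (CpN p N) `^ (p - 1) * (C1b_norm nrm f) `^ p
       * (pvar (@l1norm R d) p w k l) `^ p)
    (2 * C1b_norm nrm f * pvar (@l1norm R d) p w k l).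

Proof.
move=> p1 p2 _ _ nrmN fC1 _ xE k l kl lN.
have p0 : 0 < p by exact: lt_le_trans p1.
have nrm0 := is_norm_ge0 _ _ _ nrmN.
have F0 := @C1b_norm_ge0 R n d nrm f.
have C0 : 0 < CpN p N.
  rewrite /CpN mulr_gt0 ?powR_gt0//.
  (* [k < l <= N] forces [N >= 1], so the zeta sum contains its first term 1. *)
  have N1 := leq_ltn_trans (leq0n k) (leq_trans kl lN).
  have := zetaN_mono R _ _ (2 / p) N1; apply: lt_le_trans.
  by rewrite zetaNS powR1 /zetaN big_geq// add0r.
have X0 := pvar_ge0 R _ nrm p x.
have W0 := pvar_ge0 R _ (@l1norm R d) p w.
have Xtri a b c : (a <= b)%N -> (b <= c)%N ->
    pvar nrm p x a c <= pvar nrm p x a b + pvar nrm p x b c.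
  exact: pvar_triangle (is_normD _ _ _ nrmN).
have Wxx := pvarxx R _ (@l1norm R d) p p1 w.
have Wmono k' a b l' : (k' <= a)%N -> (a <= b)%N -> (b <= l')%N ->
    pvar (@l1norm R d) p w a b <= pvar (@l1norm R d) p w k' l'.
  exact: pvar_mono.
have Wsup := pvar_superadditive R _ (@l1norm R d) p p1 w.
have step u : (u < N)%N ->
    pvar nrm p x u u.+1 <= C1b_norm nrm f * pvar (@l1norm R d) p w u u.+1.
  (* The only link within one step is the step itself, where the increment of [x] is the drift. *)
  move=> uN; apply: (pvar_le_scale R _ _ nrm _ p _ x w _ _ nrm0 p1 F0 (leqnSn u)).
  move=> a b ua ab bu.
  have -> : a = u by clear -ua ab bu; lia.
  have -> : b = u.+1 by clear -ua ab bu; lia.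
  have lw := @nm_incr_le_pvar R _ (@l1norm R d) p p1 w u u.+1 (ltnSn u).
  apply: le_trans (ler_wpM2l F0 lw).
  have := norm_drift_le R d n nrm f w nrmN fC1 u u.+1 (x u).
  rewrite (xE u uN) [x u + _]addrC addrK.
  by under eq_bigr do rewrite !mxE.
have local a b : (a <= b)%N -> (b <= N)%N -> pvar nrm p x a b <=
    C1b_norm nrm f * (1 + CpN p N * pvar nrm p x a b) * pvar (@l1norm R d) p w a b.
  (* Monotonicity replaces the p-variation of [x] on subintervals by that on [[a, b]], which gives
     the constant factor that [pvar_le_scale] requires. *)
  move=> ab bN; apply: (pvar_le_scale R _ _ nrm _ p _ x w _ _ nrm0 p1 _ ab).
    exact: mulr_ge0 F0 (addr_ge0 ler01 (mulr_ge0 (ltW C0) (X0 a b))).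
  move=> a' b' aa' ab' bb'.
  apply: le_trans (increment_bound R p N d n nrm f w x p1 nrmN fC1 xE a' b' ab'
    (leq_trans bb' bN)) _.
  apply: (ler_wpM2r (W0 a' b')); apply: (ler_wpM2l F0); rewrite lerD2l.
  by apply: (ler_wpM2l (ltW C0)); exact: pvar_mono aa' (ltnW ab') bb'.
have small := small_variation R _ _ N _ _ X0 local k l (ltnW kl) lN.
have large := large_variation R p _ _ N _ _ p1 p2 C0 F0 X0 W0 Xtri Wxx Wmono Wsup
  step local k l (ltnW kl) lN.
move: (X0 k l) (W0 k l) small large.
move: (pvar nrm p x k l) (pvar (@l1norm R d) p w k l) => X W X0' W0' small large.
move: (C1b_norm nrm f) (CpN p N) F0 C0 small large {step local} => F C F0 C0 small large.
(* The small regime yields the second member of the maximum, the large one the first. *)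
have [Om1|Om1] := leP (2 * C * F * W) 1.
  apply: le_trans (small Om1) _; rewrite -!mulrA ler_pM2l// le_max; apply/orP; right.
  have := mulr_ge0 F0 W0'; lra.
rewrite -(ler_pM2l C0); apply: le_trans (large Om1) _.
rewrite mulrCA ler_pM2l//.
(* [(2 C F W)^p] is exactly [C] times the first member, since [C^p = C * C^(p-1)]. *)
apply: (@le_trans _ _ (C * (2 `^ p * C `^ (p - 1) * F `^ p * W `^ p))).
  rewrite !powRM ?mulr_ge0 ?(ltW C0)// -(mulr_powRB1 (ltW C0) p0).
  by rewrite le_eqVlt; apply/orP; left; apply/eqP; ring.
by rewrite ler_pM2l// le_max lexx.
Qed.
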